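(* Let $X, Y$ be locally convex Hausdorff topological vector spaces, $M: X \to Y$ a continuous linear mapping, $D \subset X$ a generalized polyhedral convex set, and $K=\{ y \in Y \mid \langle y^*_j, y \rangle \leq 0,\ j=1,\dots,q\}$ a polyhedral convex cone, where $y^*_j \in Y^*\setminus\{0\}$ for $j=1,\dots,q$. Then the efficient solution set $E$ of the problem (VLP) $\min_K\{Mx \mid x \in D\}$ is connected by line segments, i.e., for any $u, v$ in $E$ there exist some elements $u_1,\dots,u_r$ of $E$, with $u_1=u$ and $u_r=v$, such that $[u_i,u_{i+1}]\subset E$ for $i=1,2,\dots,r-1$.
   Context: All vector spaces are real. $X^*$ denotes the (continuous) dual of $X$ and $\langle x^*,x\rangle$ the value of $x^*\in X^*$ at $x\in X$; likewise for $Y$. $[a,b]=\{(1-t)a+tb\mid t\in[0,1]\}$. A subset $C\subset X$ is a generalized polyhedral convex set (generalized convex polyhedron) if there exist $x^*_i\in X^*$, $\alpha_i\in\mathbb R$, $i=1,\dots,p$, and a closed affine subspace $L\subset X$ such that $C=\{x\in X\mid x\in L,\ \langle x^*_i,x\rangle\le\alpha_i,\ i=1,\dots,p\}$. $\ell(K)=K\cap(-K)$. A vector $u\in D$ is an efficient solution of (VLP) if there is no $x\in D$ with $Mu-Mx\in K\setminus\ell(K)$; $E$ is the set of all efficient solutions. *)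

(* Defs.v *)
From HB Require Import structures.
From mathcomp Require Import all_boot all_order all_algebra.
From mathcomp Require Import boolp classical_sets reals topology normedtype.

Set Implicit Arguments.
Unset Strict Implicit.
Unset Printing Implicit Defensive.

Import Order.TTheory GRing.Theory Num.Theory.
Import numFieldNormedType.Exports.

Local Open Scope classical_set_scope.
Local Open Scope ring_scope.

(* An element of the dual X^* is f : {linear X -> R^o} with [continuous f];
   [tvsType R] is the library's class of locally convex topological vector
   spaces, to which [hausdorff_space] is added where needed. *)

(* The empty set is affine in this sense. Requiring [L !=set0] would give the
   same sets [generalized_polyhedral_convex], since the empty set is also
   defined by the inequality 0 <= -1. *)
Definition affine_subspace (R : realType) (X : lmodType R) (L : set X) : Prop :=
  forall (x y : X) (t : R), L x -> L y -> L ((1 - t) *: x + t *: y).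

Definition generalized_polyhedral_convex (R : realType) (X : tvsType R)
    (C : set X) : Prop :=
  exists (p : nat) (xs : 'I_p -> {linear X -> R^o}) (alpha : 'I_p -> R)
         (L : set X),
    [/\ forall i, continuous (xs i),
        closed L,
        affine_subspace L
      & C = [set x | L x /\ forall i, xs i x <= alpha i]].

Definition polyhedral_cone (R : realType) (Y : lmodType R) (q : nat)
    (ys : 'I_q -> {linear Y -> R^o}) : set Y :=
  [set y | forall j, ys j y <= 0].

Definition lineality (R : realType) (Y : lmodType R) (K : set Y) : set Y :=
  K `&` [set - y | y in K].

Definition efficient_set (R : realType) (X Y : lmodType R) (M : X -> Y)
    (D : set X) (K : set Y) : set X :=
  [set u | D u /\ ~ exists2 x, D x & (K `\` lineality K) (M u - M x)].

Definition line_segment (R : realType) (X : lmodType R) (a b : X) : set X :=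
  [set (1 - t) *: a + t *: b | t in [set t : R | 0 <= t <= 1]].

(* Only the values w 1, ..., w r of w : nat -> X are used; without [0 < r] the
   case r = 0 would hold vacuously, with w 0 = v. *)
Definition connected_by_line_segments (R : realType) (X : lmodType R)
    (E : set X) : Prop :=
  forall u v : X, E u -> E v ->
    exists (r : nat) (w : nat -> X),
      [/\ (0 < r)%N,
          w 1%N = u,
          w r = v,
          forall i : nat, (1 <= i <= r)%N -> E (w i)
        & forall i : nat, (1 <= i < r)%N ->
            line_segment (w i) (w i.+1) `<=` E].

(* Main.v *)
Require Import Defs.
From HB Require Import structures.
From mathcomp Require Import all_boot all_order all_algebra.
From mathcomp Require Import boolp classical_sets reals topology normedtype.
From mathcomp Require Import cardinality ring lra.
Import Order.TTheory GRing.Theory Num.Theory.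
Import numFieldNormedType.Exports.
Local Open Scope classical_set_scope.
Local Open Scope ring_scope.

Set Implicit Arguments.
Unset Strict Implicit.

(** Efficiency only concerns the functionals [ys j \o M], so the statement is
about Pareto maximal points of finitely many linear functionals [c j] over a
polyhedron [D] in a real vector space.

The Pareto maximal points are exactly the maximizers over [D] of the weighted
sums of the [c j] with positive weights. One inclusion is immediate
([argmax_pareto]). For the other one ([pareto_argmax]), no feasible direction
at a Pareto maximal [u] along which no [c j] decreases can make some [c j]
increase; Farkas' lemma, applied to the sum of the [c j], turns this into
weights greater than or equal to 1.

Let now [u] and [v] maximize the weighted sums [f] and [g]. Every functional
[f_t = (1 - t) f + t g] with [t] in [[0, 1]] is again a positive weighted sum,
so all its maximizers are Pareto maximal. It is bounded above on [D], hence has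
a maximizer, as linear programs do ([argmax_nonempty]). For a fixed [t] any two
maximizers of [f_t] are joined by a segment of maximizers; hence either all of
them or none can be reached from [u] by a polygonal path of Pareto maximal
points. Whether [x] maximizes [f_t] is determined by the set of constraints
active at [x] ([argmax_active]), and there are finitely many such sets;
consequently the times [t] at which a reachable maximizer exists form a closed
set, and so do the times at which an unreachable one exists
([closed_attained_times]). These two sets partition [[0, 1]], the first contains
0, and [[0, 1]] is connected, so the first also contains 1: the path then
reaches [v] by one more segment ([path_argmax]). *)

(** * Farkas' lemma on a subspace *)

Section Farkas.
Context {R : realFieldType} {X : lmodType R}.
Implicit Types (V : set X) (b : {linear X -> R^o}).

Definition linear_subspace V : Prop :=
  V 0 /\ forall (t : R) (x y : X), V x -> V y -> V (t *: x + y).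

(** Induction on the number of inequalities. If the implication fails without
[a j], at a point [x0] say, then [a j x0 > 0] and every vector splits as a
multiple of [x0] plus a vector of the kernel of [a j]. The induction hypothesis
gives the other multipliers on the smaller subspace [V] intersected with that
kernel, and evaluation at [x0] gives the multiplier of [a j]. Letting [V] shrink
leaves the functionals themselves unchanged throughout the induction. *)
Lemma farkas_seq (I : eqType) (a : I -> {linear X -> R^o}) b (s : seq I) V :
    uniq s -> linear_subspace V ->
    (forall x, V x -> (forall i, i \in s -> a i x <= 0) -> b x <= 0) ->
  exists2 lam : I -> R, (forall i, 0 <= lam i) &
    forall x, V x -> b x = \sum_(i <- s) lam i * a i x.
Proof.
elim: s V => [|j s IH] V /=.
  move=> _ [V0 Vlin] bV; exists (fun=> 0) => // x Vx; rewrite big_nil.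
  apply/eqP; rewrite eq_le bV// -oppr_le0 -linearN bV//.
  by rewrite -scaleN1r -[_ *: _]addr0; exact: Vlin.
move=> /andP[js us] [V0 Vlin] bV.
have [imp|/existsNP[x0 /not_implyP[Vx0 /not_implyP[ax0 /negP]]]] :=
    pselect (forall x, V x -> (forall i, i \in s -> a i x <= 0) -> b x <= 0).
  have [lam lam0 blam] := IH V us (conj V0 Vlin) imp.
  exists (fun i => if i == j then 0 else lam i) => [i|x Vx].
    by case: ifP.
  rewrite big_cons eqxx mul0r add0r blam//.
  rewrite !big_seq; apply: eq_bigr => i is_.
  by case: eqP => // ij; rewrite -ij is_ in js.
rewrite -ltNge => bx0.
have ajx0 : 0 < a j x0.
  rewrite ltNge; apply/negP => ajx0; have := bV _ Vx0.
  rewrite leNgt bx0 => /(_ _)/negP; apply => // i.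
  by rewrite inE => /orP[/eqP->//|]; exact: ax0.
pose W : set X := [set x | V x /\ a j x = 0].
have linW : linear_subspace W.
  split; first by split => //; rewrite linear0.
  move=> t x y [Vx jx] [Vy jy]; split; first exact: Vlin.
  by rewrite linearP /= jx jy scaler0 addr0.
have [|lam lam0 blam] := IH W us linW.
  move=> x [Vx jx] ax; apply: bV => // i; rewrite inE => /orP[/eqP->|/ax//].
  by rewrite jx.
pose mu : R := (b x0 - \sum_(i <- s) lam i * a i x0) / a j x0.
have mu0 : 0 <= mu.
  rewrite divr_ge0 ?(ltW ajx0)// subr_ge0 (le_trans _ (ltW bx0))//.
  rewrite big_seq; apply: sumr_le0 => i is_; exact: mulr_ge0_le0 (ax0 _ is_).
exists (fun i => if i == j then mu else lam i) => [i|x Vx]; first by case: ifP.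
rewrite big_cons eqxx.
have -> : \sum_(i <- s) (if i == j then mu else lam i) * a i x
        = \sum_(i <- s) lam i * a i x.
  rewrite !big_seq; apply: eq_bigr => i is_.
  by case: eqP => // ij; rewrite -ij is_ in js.
pose c : R := a j x / a j x0.
have Wx : W ((- c) *: x0 + x).
  split; first exact: Vlin.
  by rewrite linearP /= /c /GRing.scale/= mulNr divfK ?gt_eqF// addNr.
have := blam _ Wx; rewrite linearP /=.
under eq_bigr do rewrite linearP /= mulrDr.
rewrite big_split /= /GRing.scale/=.
under eq_bigr do rewrite mulrCA.
rewrite -mulr_sumr => E.
have -> : mu * a j x = c * (b x0 - \sum_(i <- s) lam i * a i x0).
  by rewrite /mu mulrAC -mulrA mulrC.
by move: E; lra.
Qed.

Lemma farkas (I : finType) (P : pred I) (a : I -> {linear X -> R^o}) b V :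
    linear_subspace V ->
    (forall x, V x -> (forall i, P i -> a i x <= 0) -> b x <= 0) ->
  exists2 lam : I -> R, (forall i, 0 <= lam i) &
    forall x, V x -> b x = \sum_(i | P i) lam i * a i x.
Proof.
move=> Vlin bV.
have [|lam lam0 blam] := @farkas_seq _ a b (enum P) V (enum_uniq _) Vlin.
  move=> x Vx ax; apply: bV => // i Pi; apply: ax.
  by rewrite mem_enum.
by exists lam => // x /blam->; rewrite big_enum.
Qed.

End Farkas.

(** * Maximizers of linear functionals and polygonal paths *)

Section Argmax.
Context {R : realType} {X : lmodType R}.
Implicit Types (f g : {linear X -> R^o}) (D E : set X).

Definition argmax f D : set X := [set x | D x /\ forall y, D y -> f y <= f x].

Lemma eq_argmax f g D : f =1 g -> argmax f D = argmax g D.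
Proof.
move=> fg; rewrite /argmax; congr mkset; apply/funext => x; congr (_ /\ _).
by apply/propext; split=> + y /[dup] Dy => /(_ y Dy); rewrite !fg.
Qed.

Lemma argmax_segment f D x y : line_segment x y `<=` D ->
  argmax f D x -> argmax f D y -> line_segment x y `<=` argmax f D.
Proof.
move=> xyD [_ fx] [_ fy] z xyz; split; first exact: xyD.
case: xyz => t /andP[t0 t1] <- w Dw.
rewrite linearP linearZ /= /GRing.scale/=.
have := fx _ Dw; have := fy _ Dw; nra.
Qed.

Definition interp f g (t : R) : {linear X -> R^o} := (1 - t) \*: f \+ t \*: g.

(** Each comparison of [x] with another point is an affine inequality in
[t]. *)
Lemma closed_argmax_times f g D x : closed [set t | argmax (interp f g t) D x].
Proof.
have [Dx|nDx] := pselect (D x); last first.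
  have -> : [set t | argmax (interp f g t) D x] = set0; last exact: closed0.
  by apply/seteqP; split=> // t [].
rewrite [X in closed X](_ : _ = \bigcap_(y in D)
    ((fun t : R => t * (g y - f y - (g x - f x))) @^-1`
      [set r : R | r <= f x - f y])).
  apply: closed_bigI => y _; apply: preimage_closed; last exact: closed_le.
  by move=> t _; exact: mulrr_continuous.
apply/seteqP; split=> [t [_ tx] y Dy /=|t tx].
  have := tx _ Dy; rewrite /= /GRing.scale/=; lra.
split=> // y Dy; have := tx _ Dy; rewrite /= /GRing.scale/=; lra.
Qed.

Definition polygonal_path E (u v : X) : Prop :=
  exists (r : nat) (w : nat -> X),
    [/\ (0 < r)%N, w 1%N = u, w r = v,
        forall i : nat, (1 <= i <= r)%N -> E (w i)
      & forall i : nat, (1 <= i < r)%N -> line_segment (w i) (w i.+1) `<=` E].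

Lemma polygonal_path_refl E u : E u -> polygonal_path E u u.
Proof. by move=> Eu; exists 1%N, (fun=> u); split=> // -[]. Qed.

Lemma polygonal_path_rcons E u x y :
  polygonal_path E u x -> line_segment x y `<=` E -> polygonal_path E u y.
Proof.
move=> [r [w [r0 wu wr Ew segw]]] xyE.
exists r.+1, (fun i => if (i <= r)%N then w i else y); split => //.
- by rewrite r0.
- by rewrite ltnn.
- move=> i /andP[i0 ir]; case: ifPn => [ir'|_]; first by apply: Ew; rewrite i0.
  apply: xyE; exists 1; first by rewrite /= ler01 lexx.
  by rewrite subrr scale0r add0r scale1r.
- move=> i /andP[i0 ir]; rewrite ltnS in ir; rewrite ir.
  case: ltnP => [ir'|ri]; first by apply: segw; rewrite i0.
  by have -> : i = r by [apply/eqP; rewrite eqn_leq ir]; rewrite wr.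
Qed.

End Argmax.

(** * Linear programming over a polyhedron *)

Section Polyhedron.
Context {R : realType} {X : lmodType R}.
Implicit Types (f g : {linear X -> R^o}) (E : set X).

Context {p : nat} (a : 'I_p -> {linear X -> R^o}) (alpha : 'I_p -> R).
Context (L : set X) (affL : affine_subspace L).

Definition polyhedron : set X := [set x | L x /\ forall i, a i x <= alpha i].
Local Notation D := polyhedron.

Definition active (x : X) : {set 'I_p} := finset (fun i => a i x == alpha i).

Lemma activeP x i : reflect (a i x = alpha i) (i \in active x).
Proof. by rewrite finset.in_set; exact: eqP. Qed.

(** In the proof, the point is the midpoint of two points dividing the lines
through [x], [y] and through [x], [z]: [affine_subspace] only speaks of
combinations of two points. *)
Lemma affine_direction (x y z : X) (t : R) :
  L x -> L y -> L z -> L (x + t *: (y - z)).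
Proof.
move=> Lx Ly Lz.
have -> : x + t *: (y - z) =
    (1 - 2^-1) *: ((1 - 2 * t) *: x + (2 * t) *: y)
    + 2^-1 *: ((1 - - (2 * t)) *: x + (- (2 * t)) *: z).
  rewrite !scalerDr !scalerA scalerN addrACA -scalerDl.
  have -> : (1 - 2^-1) * (1 - 2 * t) + 2^-1 * (1 - - (2 * t)) = 1 by field.
  have -> : (1 - 2^-1) * (2 * t) = t by field.
  have -> : 2^-1 * (- (2 * t)) = - t by field.
  by rewrite scale1r scaleNr.
by apply: affL; exact: affL.
Qed.

Lemma directions_subspace x : L x -> linear_subspace [set d | L (x + d)].
Proof.
move=> Lx; split=> [|t d e Ld Le] /=; first by rewrite addr0.
have := @affine_direction _ _ _ t Le Ld Lx.
by rewrite [x + d]addrC addrK addrAC -addrA.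
Qed.

Lemma line_affine x d t : L x -> L (x + d) -> L (x + t *: d).
Proof.
move=> Lx Ld; have := @affine_direction _ _ _ t Lx Ld Lx.
by rewrite [x + d]addrC addrK.
Qed.

(** Ratio test: [s] holds the slacks of the constraints and [r] their rates of
increase along a direction. *)
Lemma small_step (r s : 'I_p -> R) : (forall i, 0 <= s i) ->
    (forall i, s i = 0 -> r i <= 0) ->
  exists2 e : R, 0 < e & forall i, e * r i <= s i.
Proof.
move=> s0 rs; pose e := \big[Num.min/1]_i (if 0 < r i then s i / r i else 1).
have e0 : 0 < e.
  apply: lt_bigmin => // i _; case: ifPn => // ri.
  rewrite divr_gt0// lt_neqAle s0 andbT eq_sym; apply/eqP => /rs.
  by rewrite leNgt ri.
exists e => // i; have [ri|ri] := ltP 0 (r i); last first.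
  by rewrite (le_trans _ (s0 i))// mulr_ge0_le0// ltW.
rewrite -ler_pdivlMr//.
by apply: le_trans (bigmin_le_cond _ _ (isT : xpredT i)) _; rewrite ri.
Qed.

Lemma feasible_step x d : D x -> L (x + d) ->
    (forall i, i \in active x -> a i d <= 0) ->
  exists2 e : R, 0 < e & D (x + e *: d).
Proof.
move=> [Lx ax] Ld ad.
have [||e e0 ed] := @small_step (fun i => a i d) (fun i => alpha i - a i x).
- by move=> i; rewrite subr_ge0.
- by move=> i /eqP; rewrite subr_eq0 eq_sym => /eqP/activeP/ad.
exists e => //; split; first exact: line_affine.
by move=> i; rewrite linearD linearZ/= -lerBrDl; exact: ed.
Qed.

(** The direction from [y] to any point [z] of [D] is feasible at [x] too, since
the constraints active at [x] are active at [y]. As [x] is maximal, [f] does not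
increase in that direction. *)
Lemma argmax_active f x y : D y -> argmax f D x -> active x \subset active y ->
  argmax f D y.
Proof.
move=> Dy [Dx fx] /fintype.subsetP xy; split=> // z Dz.
have Lxd : L (x + (z - y)).
  by have := @affine_direction _ _ _ 1 Dx.1 Dz.1 Dy.1; rewrite scale1r.
have [|e e0 De] := feasible_step Dx Lxd.
  move=> i /xy/activeP ai; rewrite linearB/= ai subr_le0; exact: Dz.2.
have := fx _ De; rewrite linearD linearZ/= gerDl /GRing.scale/= pmulr_rle0//.
by rewrite linearB/= subr_le0.
Qed.

(** The ray from [x] along [d] leaves [D], because [f] is bounded above there;
at the exit point, all constraints active at [x] stay active and a new one
becomes active. *)
Lemma blocking_step f B x d : (forall y, D y -> f y <= B) -> D x -> L (x + d) ->
    (forall i, i \in active x -> a i d = 0) -> 0 < f d ->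
  exists y, [/\ D y, f x <= f y & active x \proper active y].
Proof.
move=> fB Dx Ld ad fd; have [Lx ax] := Dx.
have [i0 ai0] : exists i, 0 < a i d.
  apply: contrapT => /forallNP ad_le0.
  (* At this time [f] has the value [B + 1] on the ray. *)
  pose t := (B - f x + 1) / f d.
  have t0 : 0 <= t.
    rewrite divr_ge0 ?(ltW fd)//; have := fB _ Dx; lra.
  have : D (x + t *: d).
    split=> [|i]; first exact: line_affine.
    rewrite linearD linearZ/= (le_trans _ (ax i))// gerDl.
    by rewrite mulr_ge0_le0// leNgt; exact/negP/ad_le0.
  move=> /fB; rewrite linearD linearZ/= /GRing.scale/= divfK ?gt_eqF//; lra.
have : exists2 i1 : 'I_p, 0 < a i1 d & forall j, 0 < a j d ->
    (alpha i1 - a i1 x) / a i1 d <= (alpha j - a j x) / a j d.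
  case: (@Order.TotalTheory.arg_minP _ _ _ i0 (fun i => 0 < a i d)
    (fun i => (alpha i - a i x) / a i d) ai0) => i1 ai1 i1min.
  by exists i1.
move=> [i1 ai1 i1min]; set t := (alpha i1 - a i1 x) / a i1 d in i1min.
have t0 : 0 <= t by rewrite divr_ge0 ?subr_ge0// ltW.
exists (x + t *: d); split.
- split=> [|j]; first exact: line_affine.
  rewrite linearD linearZ/= /GRing.scale/= -lerBrDl.
  have [aj|aj] := ltP 0 (a j d); first by rewrite -ler_pdivlMr// i1min.
  by rewrite (@le_trans _ _ 0) ?subr_ge0// mulr_ge0_le0.
- by rewrite linearD linearZ/= lerDl mulr_ge0// ltW.
apply/properP; split.
  apply/fintype.subsetP => i ix; apply/activeP.
  by rewrite linearD linearZ/= ad// scaler0 addr0; exact/activeP.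
exists i1.
  apply/activeP; rewrite linearD linearZ/= /GRing.scale/= divfK ?gt_eqF//.
  by rewrite addrC subrK.
by apply/negP => /ad E; rewrite E ltxx in ai1.
Qed.

(** The active constraints at [x] determine the value [f x]: [f] is constant on
the part of [L] where they hold with equality. Points of this kind replace the
vertices of a polyhedron, which need not exist when [D] contains lines. *)
Definition active_determined f x : Prop :=
  forall d, L (x + d) -> (forall i, i \in active x -> a i d = 0) -> f d = 0.

(** [blocking_step] can be repeated until [active_determined] holds, and at most
[p] times, since each step enlarges the active set. *)
Lemma climb f B x : (forall y, D y -> f y <= B) -> D x ->
  exists y, [/\ D y, f x <= f y & active_determined f y].
Proof.
move=> fB; have [n] := ubnP #|~: active x|; elim: n x => // n IH x xn Dx.
have [xdet|] := pselect (active_determined f x); first by exists x.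
move=> /existsNP[d /not_implyP[Ld /not_implyP[ad /eqP fd]]].
have [e [Le ae fe]] : exists e, [/\ L (x + e),
    forall i, i \in active x -> a i e = 0 & 0 < f e].
  have [fd0|fd0] := ltP 0 (f d); first by exists d.
  exists (- d); split.
  - by rewrite -scaleN1r; apply: line_affine Ld; case: Dx.
  - by move=> i /ad; rewrite linearN/= => ->; rewrite oppr0.
  - by rewrite linearN/= oppr_gt0 lt_neqAle fd.
have [y [Dy xy axy]] := blocking_step fB Dx Le ae fe.
have [|//|z [Dz yz zdet]] := IH y.
  rewrite -ltnS (leq_trans _ xn)// ltnS; apply: proper_card.
  by rewrite properC.
by exists z; split=> //; exact: le_trans yz.
Qed.

(** By [climb] only points where [f] is determined by the active set compete for
the maximum, and at those points [f] takes finitely many values. *)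
Lemma argmax_nonempty f B x : (forall y, D y -> f y <= B) -> D x ->
  argmax f D !=set0.
Proof.
move=> fB Dx; have [y0 [Dy0 _ y0det]] := climb fB Dx.
pose Q (J : {set 'I_p}) : set X :=
  [set y | [/\ D y, active_determined f y & active y = J]].
pose rep J := xget 0 (Q J).
have repP y : D y -> active_determined f y ->
    Q (active y) (rep (active y)) /\ f (rep (active y)) = f y.
  move=> Dy ydet.
  have [Dr rdet rE] : Q (active y) (rep (active y)) by apply: (@xgetI _ _ _ y).
  split=> //; apply/eqP; rewrite -subr_eq0 -linearB/=; apply/eqP/ydet.
    by rewrite addrC subrK; case: Dr.
  move=> i iy; have ir : i \in active (rep (active y)) by rewrite rE.
  by rewrite linearB/= (activeP _ _ ir) (activeP _ _ iy) subrr.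
have Qy0 : `[< Q (active y0) !=set0 >] by apply/asboolP; exists y0.
case: (@Order.TotalTheory.arg_maxP _ _ _ _ (fun J => `[< Q J !=set0 >])
  (fun J => f (rep J)) Qy0) => J /asboolP[y Qy] Jmax.
have [Dr _ _] : Q J (rep J) by apply: (@xgetI _ _ _ y).
exists (rep J); split=> // z Dz.
have [w [Dw zw wdet]] := climb fB Dz.
have [Qw rw] := repP _ Dw wdet.
rewrite (le_trans zw)// -rw; apply: Jmax.
by apply/asboolP; exists w.
Qed.

(** Points with the same active set maximize [interp f g t] for the same [t], so
this is a finite union of the sets of [closed_argmax_times]. *)
Lemma closed_attained_times f g (Q : set X) :
  closed [set t | exists2 x, Q x & argmax (interp f g t) D x].
Proof.
pose T (J : {set 'I_p}) := [set t | exists x,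
  [/\ Q x, active x = J & argmax (interp f g t) D x]].
rewrite [X in closed X](_ : _ = \bigcup_(J in [set: {set 'I_p}]) T J).
  2: { apply/seteqP; split=> t [x].
         by move=> Qx tx; exists (active x) => //; exists x.
       by move=> _ [y [Qy _ ty]]; exists y. }
apply: closed_bigcup; first exact: finite_finset.
move=> J _.
have [[x [Dx Qx xJ]]|noJ] := pselect (exists x, [/\ D x, Q x & active x = J]).
  rewrite (_ : T J = [set t | argmax (interp f g t) D x]).
    exact: closed_argmax_times.
  apply/seteqP; split=> t; last by exists x.
  by move=> [y [_ yJ ty]]; apply: (argmax_active Dx ty); rewrite yJ xJ.
have -> : T J = set0; last exact: closed0.
apply/seteqP; split=> // t [y [Qy yJ ty]].
by apply: noJ; exists y; split=> //; case: ty.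
Qed.

Lemma polyhedron_segment x y : D x -> D y -> line_segment x y `<=` D.
Proof.
move=> [Lx ax] [Ly ay] _ [t /andP[t0 t1] <-]; split=> [|i]; first exact: affL.
rewrite linearP linearZ /= /GRing.scale/=; have := ax i; have := ay i; nra.
Qed.

Lemma path_argmax f g E u v : argmax f D u -> argmax g D v ->
    (forall t : R, 0 <= t <= 1 -> argmax (interp f g t) D `<=` E) ->
  polygonal_path E u v.
Proof.
move=> fu gv sE.
have i0 : argmax (interp f g 0) D = argmax f D.
  apply: eq_argmax => x.
  by rewrite /= /GRing.scale/= subr0 mul1r mul0r addr0.
have i1 : argmax (interp f g 1) D = argmax g D.
  apply: eq_argmax => x.
  by rewrite /= /GRing.scale/= subrr mul1r mul0r add0r.
have join (t : R) x y : 0 <= t <= 1 -> argmax (interp f g t) D x ->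
    argmax (interp f g t) D y -> line_segment x y `<=` E.
  move=> t01 tx ty; apply: subset_trans (sE _ t01).
  apply: argmax_segment => //.
  by apply: polyhedron_segment; [case: tx|case: ty].
pose reached t := exists2 x, polygonal_path E u x & argmax (interp f g t) D x.
pose missed t := exists2 x, ~ polygonal_path E u x & argmax (interp f g t) D x.
have dichotomy (t : R) : 0 <= t <= 1 -> reached t <-> ~ missed t.
  move=> t01; split=> [[x ux tx] [y uy ty]|nmissed].
    by apply/uy/(polygonal_path_rcons ux)/join; [exact: t01|..].
  have [x tx] : argmax (interp f g t) D !=set0.
    apply: (@argmax_nonempty _ ((1 - t) * f u + t * g v) u); last by case: fu.
    move=> y Dy /=; rewrite /GRing.scale/=.
    have := fu.2 _ Dy; have := gv.2 _ Dy; case/andP: t01; nra.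
  by exists x => //; apply: contrapT => ux; apply: nmissed; exists x.
have all_reached : `[0, 1]%classic `&` reached = `[0, 1]%classic.
  apply: segment_connected.
  - exists 0; split; first by rewrite /= in_itv/= lexx ler01.
    exists u; last by rewrite i0.
    by apply: polygonal_path_refl; apply: (sE 0); rewrite ?lexx ?ler01// i0.
  - exists (~` missed).
      by apply: closed_openC; exact: closed_attained_times.
    apply/seteqP; split=> t [] /=; rewrite in_itv/=;
      by move=> t01 /(dichotomy _ t01).
  - by exists reached => //; exact: closed_attained_times.
have [x ux] : reached 1.
  have I1 : `[0, 1]%classic (1 : R) by rewrite /= in_itv/= ler01 lexx.
  by move: I1; rewrite -all_reached => -[].
move=> tx; apply: (polygonal_path_rcons ux).
by apply: (join 1) tx _; rewrite ?ler01 ?lexx// i1.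
Qed.

End Polyhedron.

(** * Pareto maximal points and weighted sums *)

Section Pareto.
Context {R : realType} {X : lmodType R} {q : nat}.
Context (c : 'I_q -> {linear X -> R^o}).

Definition pareto (D : set X) : set X :=
  [set u | D u /\ ~ exists2 x, D x &
    (forall j, c j u <= c j x) /\ exists j, c j u < c j x].

Definition weighted_sum (w : 'I_q -> R) (x : X) : R^o := \sum_j w j * c j x.

Lemma weighted_sum_is_linear w : linear (weighted_sum w).
Proof.
move=> t x y; rewrite /weighted_sum scaler_sumr -big_split.
by apply: eq_bigr => j _; rewrite linearP /= /GRing.scale/= mulrDr mulrCA.
Qed.

HB.instance Definition _ w := GRing.isLinear.Build R X R^o _
  (weighted_sum w) (weighted_sum_is_linear w).

Lemma argmax_pareto w D : (forall j, 0 < w j) ->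
  argmax (weighted_sum w) D `<=` pareto D.
Proof.
move=> w0 u [Du umax]; split=> // -[x Dx [cx [k ck]]].
have := umax _ Dx; rewrite leNgt => /negP; apply.
rewrite /= /weighted_sum (bigD1 k)//= [ltRHS](bigD1 k)//= ltr_leD ?ltr_pM2l//.
by apply: ler_sum => j _; rewrite ler_pM2l.
Qed.

(** Farkas' lemma expresses the sum of the [c k] through the active constraints
and the functionals [- c j], with nonnegative multipliers [lam]. Moving the
[- c j] to the other side gives the weights [1 + lam (inr j)], whose weighted
sum is a nonnegative combination of active constraints and so does not increase
in any feasible direction. *)
Lemma pareto_argmax p (a : 'I_p -> {linear X -> R^o}) (alpha : 'I_p -> R) L u :
    affine_subspace L -> pareto (polyhedron a alpha L) u ->
  exists2 w : 'I_q -> R, (forall j, 0 < w j) &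
    argmax (weighted_sum w) (polyhedron a alpha L) u.
Proof.
move=> affL [Du upar]; have [Lu au] := Du.
pose h (k : 'I_p + 'I_q) : {linear X -> R^o} :=
  match k with inl i => a i | inr j => \- c j end.
pose P (k : 'I_p + 'I_q) := if k is inl i then i \in active a alpha u else true.
have [d Ld hd|lam lam0 lamE] :=
    @farkas _ _ _ P h (weighted_sum (fun=> 1)) _ (directions_subspace affL Lu).
  apply: sumr_le0 => k _; rewrite mul1r leNgt; apply/negP => ck.
  have [i ui|e e0 De] := feasible_step affL Du Ld; first exact: (hd (inl i)).
  apply: upar; exists (u + e *: d) => //; split=> [j|].
    rewrite linearD linearZ/= lerDl mulr_ge0 ?(ltW e0)//.
    by have := hd (inr j) isT; rewrite /= oppr_le0.
  by exists k; rewrite linearD linearZ/= ltrDl mulr_gt0.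
exists (fun j => 1 + lam (inr j)) => [j|]; first by rewrite ltr_pwDl.
split=> // x [Lx ax].
rewrite -subr_le0 -linearB/=.
have Lxu : L (u + (x - u)) by rewrite addrC subrK.
have := lamE _ Lxu; rewrite /= big_sumType/= /weighted_sum => E.
under eq_bigr do rewrite mulrDl.
rewrite big_split/= E -addrA -big_split/= [X in _ + X]big1 ?addr0.
  apply: sumr_le0 => i ui; rewrite mulr_ge0_le0// linearB/=.
  by rewrite (activeP _ _ _ _ ui) subr_le0.
by move=> j _; rewrite mulrN addNr.
Qed.

End Pareto.

Theorem pareto_connected (R : realType) (X : lmodType R) (p q : nat)
    (a : 'I_p -> {linear X -> R^o}) (alpha : 'I_p -> R) (L : set X)
    (c : 'I_q -> {linear X -> R^o}) : affine_subspace L ->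
  connected_by_line_segments (pareto c (polyhedron a alpha L)).
Proof.
move=> affL u v /(pareto_argmax affL)[w w0 uw] /(pareto_argmax affL)[z z0 vz].
apply: (path_argmax affL uw vz) => t t01.
rewrite (@eq_argmax _ _ _ (weighted_sum c (fun j => (1 - t) * w j + t * z j))).
  apply: argmax_pareto => j; have := w0 j; have := z0 j; case/andP: t01; nra.
move=> x; rewrite /= /GRing.scale/= /weighted_sum !mulr_sumr -big_split.
by apply: eq_bigr => j _; rewrite [RHS]mulrDl !mulrA.
Qed.

(** [M u - M x] lies in the cone when no [ys j (M x)] is less than
[ys j (M u)], so minimizing for the cone means maximizing the [ys j \o M]. *)
Lemma efficient_pareto (R : realType) (X Y : lmodType R) (M : {linear X -> Y})
    (D : set X) (q : nat) (ys : 'I_q -> {linear Y -> R^o}) :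
  efficient_set M D (polyhedral_cone ys) = pareto (fun j => ys j \o M) D.
Proof.
apply/funext => u; rewrite /efficient_set /pareto /=; congr (_ /\ ~ _).
apply/propext; split=> -[x Dx].
  move=> [Kx lx]; exists x => //; split=> [j|].
    by have := Kx j; rewrite linearB/= subr_le0.
  apply: contrapT => /forallNP noj; apply: lx; split=> //.
  exists (M x - M u); last by rewrite opprB.
  move=> j; rewrite linearB/= subr_le0 leNgt; exact/negP/noj.
move=> [cx [k ck]]; exists x => //; split=> [j|[_ [y Ky yE]]].
  by rewrite linearB/= subr_le0; exact: cx.
have := Ky k; rewrite -[y]opprK yE opprB linearB/= subr_le0 leNgt.
by rewrite ck.
Qed.

Theorem theorem3p3 (R : realType) (X Y : tvsType R)
    (hX : hausdorff_space X) (hY : hausdorff_space Y)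
    (M : {linear X -> Y}) (hM : continuous M)
    (D : set X) (hD : generalized_polyhedral_convex D)
    (q : nat) (ys : 'I_q -> {linear Y -> R^o})
    (hys : forall j, continuous (ys j))
    (hys0 : forall j, (ys j : Y -> R^o) <> (fun=> 0)) :
  connected_by_line_segments (efficient_set M D (polyhedral_cone ys)).
Proof.
have [p [xs [alpha [L [_ _ affL ->]]]]] := hD.
rewrite efficient_pareto; exact: pareto_connected.
Qed.
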